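(* Let $A$ be a real finite-dimensional affine space and consider any metric $m\in\mathrm{Met}(A)=\mathrm{Quad}(A)/\mathrm{Aff}(A)$. - For each point $P\in A$ there exists a unique $m$-quadratic function $\delta^m_P\in\mathrm{Quad}(A)$ that is homogeneous at $P$. - For each affine referential $\mathcal R=(R_0,\dots,R_n)$ of $A$ there exists a unique $m$-quadratic function $\delta^m_{\mathcal R}\in\mathrm{Quad}(A)$ that vanishes at every point of the referential.
   Context: All spaces are real and finite-dimensional. $\mathrm{Aff}(A)$ is the vector space of affine functions $A\to\mathbb R$. A function $\delta:A\to\mathbb R$ is quadratic if $\delta(\alpha P+\beta Q)=\alpha(\alpha-\beta)\delta(P)+\beta(\beta-\alpha)\delta(Q)+4\alpha\beta\,\delta(\frac{P+Q}2)$ for all $P,Q\in A$ and reals $\alpha+\beta=1$; $\mathrm{Quad}(A)\supseteq\mathrm{Aff}(A)$ is the vector space of these. Elements of the quotient $\mathrm{Met}(A)=\mathrm{Quad}(A)/\mathrm{Aff}(A)$ are called metrics, and the representatives $\delta\in\mathrm{Quad}(A)$ of a metric $m$ are called $m$-quadratic functions. A quadratic function $\delta$ is homogeneous at $P$ if $\delta(P)=0$ and $\delta$ is even with respect to $P$: $\delta(2P-Q)=\delta(Q)$ for all $Q\in A$. An affine referential is a sequence of $n+1$ affinely independent points, $n=\dim A$. *)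

(* Defs.v *)
From HB Require Import structures.
From mathcomp Require Import all_boot all_order all_algebra.
From mathcomp Require Import ring lra.
From mathcomp Require Import boolp classical_sets functions reals.

Set Implicit Arguments.
Unset Strict Implicit.
Unset Printing Implicit Defensive.

Import GRing.Theory Num.Theory.

Local Open Scope ring_scope.
Local Open Scope quotient_scope.

(* Nonempty affine spaces with space of translations V: V acts by vtrans, and
   apdiff P Q is the unique vector that carries P to Q. *)
HB.mixin Record isAffineSpace (R : realType) (V : vectType R) (A : Type) := {
  vtrans : A -> V -> A;
  apdiff : A -> A -> V;
  affine_inhabited : inhabited A;
  vtrans0 : forall P, vtrans P 0 = P;
  vtransD : forall P u v, vtrans P (u + v) = vtrans (vtrans P u) v;
  apdiffK : forall P Q, vtrans P (apdiff P Q) = Q;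
  vtransK : forall P v, apdiff P (vtrans P v) = v
}.

#[short(type="affineType")]
HB.structure Definition AffineSpace (R : realType) (V : vectType R) :=
  {A of isAffineSpace R V A}.

Definition affine_dim (R : realType) (V : vectType R) (A : affineType V) : nat :=
  \dim {:V}.

Section Functions.
Variables (R : realType) (V : vectType R) (A : affineType V).
Implicit Types (P Q : A) (a b : R) (f : A -> R^o).

(* The point a P + b Q for a + b = 1, that is P + b (Q - P): the weight a is
   determined by b and does not occur on the right-hand side. *)
Definition bary a P b Q : A := vtrans P (b *: apdiff P Q).

Definition midpoint P Q : A := bary 2^-1 P 2^-1 Q.

Definition is_affine f : Prop :=
  forall P Q a b, a + b = 1 -> f (bary a P b Q) = a * f P + b * f Q.

Definition is_quadratic f : Prop :=
  forall P Q a b, a + b = 1 ->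
    f (bary a P b Q) =
      a * (a - b) * f P + b * (b - a) * f Q + 4 * a * b * f (midpoint P Q).

Definition quad_pred : {pred A -> R^o} := fun f => `[< is_quadratic f >].

Lemma quad_predP f : reflect (is_quadratic f) (f \in quad_pred).
Proof. exact: asboolP. Qed.

Lemma is_affine_quadratic f : is_affine f -> is_quadratic f.
Proof.
move=> af P Q a b ab; rewrite /midpoint !af //; last by lra.
by have -> : a = 1 - b; [lra | field].
Qed.

Fact quad_submod_closed : submod_closed quad_pred.
Proof.
split=> [|c f g /quad_predP qf /quad_predP qg]; apply/quad_predP => P Q a b ab.
  by rewrite /= !mulr0 !addr0.
by rewrite !fctE /GRing.scale /= qf // qg //; ring.
Qed.

HB.instance Definition _ :=
  GRing.isSubmodClosed.Build R (A -> R^o) quad_pred quad_submod_closed.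

End Functions.

Record Quad (R : realType) (V : vectType R) (A : affineType V) := MkQuad {
  quad_fun :> A -> R^o;
  _ : quad_fun \in @quad_pred R V A
}.

HB.instance Definition _ (R : realType) (V : vectType R) (A : affineType V) :=
  [isSub for @quad_fun R V A].
HB.instance Definition _ (R : realType) (V : vectType R) (A : affineType V) :=
  [Choice of Quad A by <:].
HB.instance Definition _ (R : realType) (V : vectType R) (A : affineType V) :=
  [SubChoice_isSubLmodule of Quad A by <:].

Section Metrics.
Variables (R : realType) (V : vectType R) (A : affineType V).

Definition Aff : {pred Quad A} := fun d => `[< is_affine d >].

Lemma AffP (d : Quad A) : reflect (is_affine d) (d \in Aff).
Proof. exact: asboolP. Qed.

Fact Aff_submod_closed : submod_closed Aff.
Proof.
split=> [|c f g /AffP af /AffP ag]; apply/AffP => P Q a b ab.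
  by rewrite /= !mulr0 !addr0.
rewrite -[quad_fun _]/((c *: quad_fun f) + quad_fun g).
by rewrite !fctE /GRing.scale /= af // ag //; ring.
Qed.

HB.instance Definition _ :=
  GRing.isSubmodClosed.Build R (Quad A) Aff Aff_submod_closed.

Definition Met : Type := Quotient.quot Aff.
HB.instance Definition _ := ZmodQuotient.on Met.

Definition met_scale (a : R) (m : Met) : Met := \pi_Met (a *: repr m).

Lemma pi_scale a (d : Quad A) : met_scale a (\pi_Met d) = \pi_Met (a *: d).
Proof.
apply/eqP; rewrite -Quotient.idealrBE -scalerBr rpredZ //.
by rewrite Quotient.idealrBE reprK.
Qed.

Let piD : {morph \pi_Met : d e / d + e}.
Proof. exact: (raddfD (\pi_(Quotient.quot Aff))). Qed.

Fact met_scaleA a b m : met_scale a (met_scale b m) = met_scale (a * b) m.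
Proof. by elim/quotW: m => d; rewrite (pi_scale b d) !pi_scale scalerA. Qed.

Fact met_scale1 : left_id 1 met_scale.
Proof. by elim/quotW => d; rewrite pi_scale scale1r. Qed.

Fact met_scaleDr : right_distributive met_scale +%R.
Proof.
move=> a; elim/quotW => d; elim/quotW => e.
by rewrite (pi_scale a d) (pi_scale a e) -!piD pi_scale scalerDr.
Qed.

Fact met_scaleDl m : {morph met_scale^~ m : a b / a + b}.
Proof. by elim/quotW: m => d a b; rewrite !(pi_scale _ d) scalerDl piD. Qed.

HB.instance Definition _ := GRing.Zmodule_isLmodule.Build R Met
  met_scaleA met_scale1 met_scaleDr met_scaleDl.

Definition m_quadratic (m : Met) (d : Quad A) : Prop := \pi_Met d = m.

(* The point 2P - Q is bary 2 P (-1) Q. *)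
Definition homogeneous_at (P : A) (d : Quad A) : Prop :=
  d P = 0 /\ forall Q : A, d (bary 2 P (-1) Q) = d Q.

Definition affinely_independent n (S : 'I_n.+1 -> A) : Prop :=
  free [seq apdiff (S ord0) (S (lift ord0 i)) | i : 'I_n].

Definition affine_referential (S : 'I_(affine_dim A).+1 -> A) : Prop :=
  affinely_independent S.

End Metrics.

Arguments Met {R V} A.

(* Main.v *)
Require Import Defs.
From HB Require Import structures.
From mathcomp Require Import all_boot all_order all_algebra.
From mathcomp Require Import boolp classical_sets functions reals.
From mathcomp Require Import ring lra.

(** Both normalizations, being homogeneous at [P] and vanishing on a
    referential, cut out a subspace of [Quad A] complementary to [Aff A], and a
    complement meets every class of the quotient [Met A] in exactly one element
    ([exists_unique_representative]).

    For homogeneity at [P], an affine function that vanishes at [P] is odd about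
    [P], so it is also even only if it is zero.  Conversely a quadratic [d] is
    the sum of its even and odd parts about [P]; the odd part is affine
    ([odd_quadratic_affine]), and subtracting it together with the constant
    [d P] leaves a function homogeneous at [P].

    That odd quadratic functions are affine is the heart of the matter.  The
    defining identity only speaks of one line at a time: it says that the
    function is a polynomial of degree at most 2 on each line.  On a line
    through the centre, oddness leaves only the linear term, so an odd quadratic
    function is homogeneous of degree 1.  To get additivity, a point of the plane
    of two vectors [u] and [v] is reached in two ways, on the line through
    (multiples of) [u] and [v], and on the line through [u] and [-v]; comparing
    the two values at two such points yields linear equations that determine the
    values at [u + v] and [u - v].

    For a referential, the vectors from [S 0] to the other points form a basis of
    the space of translations, and an affine function is a constant plus a linear
    form, so affine functions are freely determined by their values on [S].
    Subtracting from [d] the affine function with the same values on [S] gives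
    the representative. *)

Set Implicit Arguments.
Unset Strict Implicit.
Unset Printing Implicit Defensive.

Import GRing.Theory Num.Theory.

Local Open Scope ring_scope.
Local Open Scope quotient_scope.

(** * Affine and quadratic functions seen from an origin *)

Section AffineSpace.
Variables (R : realType) (V : vectType R) (A : affineType V).
Implicit Types (O P Q : A) (u v w : V) (f : A -> R^o).

(** Choosing an origin turns barycentres into linear combinations of vectors;
    all later arguments about functions on [A] go through this identity. *)
Lemma bary_vtrans O a u b v : a + b = 1 ->
  bary a (vtrans O u) b (vtrans O v) = vtrans O (a *: u + b *: v).
Proof.
move=> ab; rewrite /bary.
have -> : apdiff (vtrans O u) (vtrans O v) = v - u.
  by rewrite -[v in LHS](addrNK u) addrC vtransD vtransK addrC.
rewrite -vtransD; congr (vtrans _ _).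
by rewrite -[X in X + _]scale1r -ab scalerDl scalerBr addrA addrAC addrK.
Qed.

Lemma is_affineP O f :
  is_affine f <-> forall u v a b, a + b = 1 ->
    f (vtrans O (a *: u + b *: v)) = a * f (vtrans O u) + b * f (vtrans O v).
Proof.
split=> [af u v a b ab|H P Q a b ab]; first by rewrite -bary_vtrans // af.
by rewrite -(apdiffK O P) -(apdiffK O Q) bary_vtrans // H.
Qed.

Lemma is_quadraticP O f :
  is_quadratic f <-> forall u v a b, a + b = 1 ->
    f (vtrans O (a *: u + b *: v)) =
      a * (a - b) * f (vtrans O u) + b * (b - a) * f (vtrans O v)
      + 4 * a * b * f (vtrans O (2^-1 *: (u + v))).
Proof.
have half : 2^-1 + 2^-1 = 1 :> R by lra.
split=> [qf u v a b ab|H P Q a b ab].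
  by rewrite -bary_vtrans // qf // /midpoint bary_vtrans // scalerDr.
rewrite -(apdiffK O P) -(apdiffK O Q) /midpoint !bary_vtrans // H //.
by rewrite scalerDr.
Qed.

Lemma linear_is_affine O c (g : {linear V -> R^o}) :
  is_affine (fun Q => c + g (apdiff O Q)).
Proof.
apply/(is_affineP O) => u v a b ab; rewrite !vtransK linearD !linearZ /=.
rewrite /GRing.scale /=; have -> : a = 1 - b by lra.
by ring.
Qed.

(** Affine combinations of [O], [O + 2 a u] and [O + 2 v] already produce all
    linear combinations, so the two-point condition is enough for linearity. *)
Lemma affine_linear O f : is_affine f ->
  linear (fun v => f (vtrans O v) - f O : R^o).
Proof.
move/(is_affineP O) => af.
have fZ t v : f (vtrans O (t *: v)) = (1 - t) * f O + t * f (vtrans O v).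
  by rewrite -{2}(vtrans0 O) -af ?scaler0 ?add0r //; ring.
move=> a u v.
have -> : a *: u + v = 2^-1 *: ((2 * a) *: u) + 2^-1 *: (2 *: v).
  by rewrite !scalerA mulrA mulVf ?pnatr_eq0 // mul1r scale1r.
rewrite af; last by lra.
by rewrite !fZ /GRing.scale /=; field.
Qed.

(** Along a line through [O] an odd function has no constant and no quadratic
    term. *)
Lemma odd_quadratic_homogeneous O f : is_quadratic f ->
  (forall v, f (vtrans O (- v)) = - f (vtrans O v)) ->
  forall t v, f (vtrans O (t *: v)) = t * f (vtrans O v).
Proof.
move=> /(is_quadraticP O) qf oddf.
have f0 : f (vtrans O 0) = 0 by have := oddf 0; rewrite oppr0; lra.
have fline t v : f (vtrans O (t *: v)) =
    t * (2 * t - 1) * f (vtrans O v)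
    + 4 * t * (1 - t) * f (vtrans O (2^-1 *: v)).
  have := qf 0 v (1 - t) t; rewrite scaler0 !add0r f0 => ->; by [ring|lra].
move=> t v.
(* The value t = -1, where oddness applies, gives the value at the midpoint. *)
by have := fline (-1) v; rewrite scaleN1r oddf fline; nra.
Qed.

(** The degree bound holds only line by line, so additivity has to be extracted
    from lines off the origin: the values at [a u + v], computed on the line
    through [u] and [v] and on the line through [u] and [-v], agree for two
    choices of the real [a] only if [u + v] has the expected value. *)
Lemma odd_quadratic_affine O f : is_quadratic f ->
  (forall v, f (vtrans O (- v)) = - f (vtrans O v)) -> is_affine f.
Proof.
move=> qf oddf; have fZ := odd_quadratic_homogeneous qf oddf.
move/(is_quadraticP O): qf => qf.
pose g v : R := f (vtrans O v).
have gZ t v : g (t *: v) = t * g v by exact: fZ.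
have gN v : g (- v) = - g v by exact: oddf.
(* Homogeneity clears the normalization a + b = 1 of the weights. *)
have gL a b u v : a + b != 0 ->
    (a + b) * g (a *: u + b *: v) =
      a * (a - b) * g u + b * (b - a) * g v + 2 * a * b * g (u + v).
  move=> ab0.
  have := qf u v (a / (a + b)) (b / (a + b)).
  rewrite -mulrDl divff // => /(_ erefl); rewrite -!/(g _) gZ.
  rewrite ![_ / (a + b)]mulrC -!scalerA -scalerDr gZ => E.
  have -> : g (a *: u + b *: v) = (a + b) * ((a + b)^-1 * g (a *: u + b *: v)).
    by rewrite mulrA divff // mul1r.
  by rewrite E; field.
have gD u v : g (u + v) = g u + g v.
  (* Each of 2u + v and 3u + v lies, up to a factor, on the line through u and
     v and on the line through u and -v. *)
  have two_lines a : a + 1 != 0 -> a - 1 != 0 -> a != 0 ->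
      2 * (a * g u - g v) = (a - 1) * g (u + v) + (a + 1) * g (u - v).
    move=> a1 a2 a0.
    have := gL a 1 u v a1; have := gL a (-1) u (- v) a2.
    rewrite scaleN1r opprK scale1r gN => E1 E2.
    have : 2 * a * (2 * (a * g u - g v)) =
       2 * a * ((a - 1) * g (u + v) + (a + 1) * g (u - v)).
      have : (a - 1) * ((a + 1) * g (a *: u + v)) =
             (a + 1) * ((a - 1) * g (a *: u + v)) by ring.
      by rewrite E1 E2; nra.
    by apply: mulfI; rewrite mulf_neq0 // pnatr_eq0.
  have := two_lines 2; have := two_lines 3.
  by move=> /(_ ltac:(lra) ltac:(lra) ltac:(lra)) E3
            /(_ ltac:(lra) ltac:(lra) ltac:(lra)) E2; lra.
by apply/(is_affineP O) => u v a b _; rewrite -!/(g _) gD !gZ.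
Qed.

Lemma quadratic_opp O f : is_quadratic f ->
  is_quadratic (fun Q => f (vtrans O (- apdiff O Q))).
Proof.
move/(is_quadraticP O) => qf; apply/(is_quadraticP O) => u v a b ab.
by rewrite !vtransK opprD -!scalerN qf // -opprD.
Qed.

Lemma odd_part_affine O f : is_quadratic f ->
  is_affine (fun Q => (f Q - f (vtrans O (- apdiff O Q))) / 2).
Proof.
move=> qf; apply: (@odd_quadratic_affine O) => [P Q a b ab|v].
  by rewrite qf // (quadratic_opp O qf) //; field.
by rewrite !vtransK opprK; field.
Qed.

Lemma symmetry_vtrans O Q : bary 2 O (-1) Q = vtrans O (- apdiff O Q).
Proof. by rewrite /bary scaleN1r. Qed.

End AffineSpace.

(** * Normalized representatives of a metric *)

Section Representatives.
Variables (R : realType) (V : vectType R) (A : affineType V).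
Implicit Types (d e : Quad A) (m : Met A) (K : Quad A -> Prop).

Definition quad_of_affine (f : A -> R^o) (af : is_affine f) : Quad A :=
  MkQuad (introT (quad_predP f) (is_affine_quadratic af)).

Lemma quad_of_affine_Aff (f : A -> R^o) (af : is_affine f) :
  quad_of_affine af \in @Aff R V A.
Proof. exact/AffP. Qed.

Lemma quadB d e Q : (d - e) Q = d Q - e Q.
Proof. by []. Qed.

Lemma quad_eq0 d : (forall Q, d Q = 0) -> d = 0.
Proof. by move=> d0; apply/val_inj/funext => Q; exact: d0. Qed.

Lemma quadraticP d : is_quadratic d.
Proof. by apply/quad_predP; exact: (valP d). Qed.

Lemma eq_metric d e : \pi_(Met A) d = \pi_(Met A) e <-> d - e \in @Aff R V A.
Proof. by rewrite (Quotient.idealrBE (@Aff R V A)); split=> /eqP. Qed.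

(** The hypotheses say that [K] is a complement of [Aff A] in [Quad A]: two
    representatives of a metric differ by an element of [Aff A], so [K] selects
    one of them. *)
Lemma exists_unique_representative K :
  (forall d e, K d -> K e -> K (d - e)) ->
  (forall d, d \in @Aff R V A -> K d -> d = 0) ->
  (forall d, exists2 e, e \in @Aff R V A & K (d - e)) ->
  forall m, exists! d, m_quadratic m d /\ K d.
Proof.
move=> KB K0 KE; elim/quotW => d; have [e eA Kde] := KE d.
exists (d - e); split.
  by split=> //; apply/eq_metric; rewrite addrAC subrr add0r rpredN.
move=> d' [md' Kd']; apply/subr0_eq/K0; last exact: KB.
have /eq_metric : \pi_(Met A) d = \pi_(Met A) d' by [].
by rewrite addrAC => dA; rewrite rpredB.
Qed.

Lemma homogeneous_representative m (P : A) :
  exists! d : Quad A, m_quadratic m d /\ homogeneous_at P d.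
Proof.
apply: exists_unique_representative.
- move=> d e [dP dE] [eP eE].
  by split=> [|Q]; rewrite !quadB ?dP ?eP ?subrr // dE eE.
- move=> d /AffP af [dP dE]; apply: quad_eq0 => Q.
  by have := dE Q; rewrite af ?dP; lra.
(* The odd part of d about P plus the constant d P. *)
move=> d; pose h Q := d P + (d Q - d (vtrans P (- apdiff P Q))) / 2.
have hA : is_affine h.
  move=> S T a b ab; rewrite /h (odd_part_affine P (quadraticP d)) //.
  by have -> : a = 1 - b; [lra | ring].
exists (quad_of_affine hA); first exact: quad_of_affine_Aff.
have PP : apdiff P P = 0 by rewrite -{2}(vtrans0 P) vtransK.
split=> [|Q]; rewrite !quadB /= /h.
  by rewrite PP oppr0 vtrans0; lra.
by rewrite !symmetry_vtrans vtransK opprK apdiffK; field.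
Qed.

Section Referential.
Variable S : 'I_(affine_dim A).+1 -> A.
Hypothesis refS : affine_referential S.

Let X := [tuple apdiff (S ord0) (S (lift ord0 i)) | i < affine_dim A].

Let nthX (i : 'I_(affine_dim A)) : X`_i = apdiff (S ord0) (S (lift ord0 i)).
Proof. by rewrite -tnth_nth tnth_mktuple. Qed.

Let freeX : free X.
Proof. exact: refS. Qed.

Let X_expansion v : v = \sum_i coord X i v *: X`_i.
Proof.
apply: coord_span.
have /andP[/eqP -> _] : basis_of fullv X; last exact: memvf.
by rewrite basisEfree freeX subvf size_tuple leqnn.
Qed.

Lemma affine_vanishing_on_referential (f : A -> R^o) :
  is_affine f -> (forall i, f (S i) = 0) -> forall Q, f Q = 0.
Proof.
move=> af fS Q; have lf := affine_linear (S ord0) af.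
pose l v : R^o := f (vtrans (S ord0) v) - f (S ord0).
pose g : {linear V -> R^o} := HB.pack l (GRing.isLinear.Build _ _ _ _ l lf).
have : g (apdiff (S ord0) Q) = 0.
  rewrite [apdiff _ Q]X_expansion linear_sum big1 // => i _.
  by rewrite linearZ nthX /= /l apdiffK !fS subrr scaler0.
by rewrite /= /l apdiffK fS subr0.
Qed.

Lemma affine_interpolation (c : 'I_(affine_dim A).+1 -> R) :
  exists2 f : A -> R^o, is_affine f & forall i, f (S i) = c i.
Proof.
pose l v : R^o := \sum_i coord X i v * (c (lift ord0 i) - c ord0).
have ll : linear l.
  move=> a u v; rewrite /l /GRing.scale /= mulr_sumr -big_split /=.
  by apply: eq_bigr => i _; rewrite linearP /= mulrDl mulrA.
pose g : {linear V -> R^o} := HB.pack l (GRing.isLinear.Build _ _ _ _ l ll).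
exists (fun Q => c ord0 + g (apdiff (S ord0) Q)); first exact: linear_is_affine.
move=> i; case: (unliftP ord0 i) => [j|] ->; last first.
  by rewrite -{2}(vtrans0 (S ord0)) vtransK linear0 addr0.
rewrite /= /l -nthX (bigD1 j) //= big1 => [|k kj]; rewrite coord_free //.
  by rewrite eqxx mul1r addr0 subrKC.
by rewrite eq_sym (negPf kj) mul0r.
Qed.

Lemma referential_representative m :
  exists! d : Quad A, m_quadratic m d /\ forall i, d (S i) = 0.
Proof.
apply: exists_unique_representative.
- by move=> d e dS eS i; rewrite quadB dS eS subrr.
- move=> d /AffP af dS; apply: quad_eq0.
  exact: affine_vanishing_on_referential.
move=> d; have [f af fS] := affine_interpolation (fun i => d (S i)).
exists (quad_of_affine af); first exact: quad_of_affine_Aff.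
by move=> i; rewrite quadB /= fS subrr.
Qed.

End Referential.

End Representatives.

Theorem proposition4p1 (R : realType) (V : vectType R) (A : affineType V)
    (m : Met A) :
  (forall P : A, exists! d : Quad A, m_quadratic m d /\ homogeneous_at P d) /\
  (forall S : 'I_(affine_dim A).+1 -> A, affine_referential S ->
     exists! d : Quad A,
       m_quadratic m d /\ forall i : 'I_(affine_dim A).+1, d (S i) = 0).
Proof.
split=> [P|S refS]; first exact: homogeneous_representative.
exact: referential_representative.
Qed.
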